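(* If $\{\mathcal{I}_j\}$ generates a SK, then $\mathsf{S}_{\mathrm{L}}(\{\mathcal{I}_j\})=\mathsf{M}^\star(\{\mathcal{J}^\star_j\})=\left|\bigcup_j\mathcal{J}^\star_j\right|-1$, where $\{\mathcal{J}^\star_j\}$ is any minimum $1$-critical subfamily of $\{\mathcal{I}_j\}$.
   Context: Network model: $n$ clients $c_1,\dots,c_n$, finite sets $\mathcal{I}_1,\dots,\mathcal{I}_n$ of message indices (the family $\{\mathcal{I}_j\}$); messages $X_i$ ($i\in\bigcup_j\mathcal{I}_j$) i.i.d. uniform on a finite field $\mathbb{F}$ with $|\mathbb{F}|>n$; client $c_j$ holds $\{X_i:i\in\mathcal{I}_j\}$; $\underline{X}$ is the vector of all messages. A protocol: in each of $t$ rounds one client broadcasts to all an element of $\mathbb{F}$ that is a function of its own messages, the round index, and all previous broadcasts; $\mathbf{T}(\underline{X})\in\mathbb{F}^t$ collects the broadcasts. Linear protocol: each broadcast is an $\mathbb{F}$-linear combination of the transmitter's messages. A protocol generates a SK if there are functions $\mathsf{k}_j$ with $K=\mathsf{k}_1(\{X_i:i\in\mathcal{I}_1\},\mathbf{T}(\underline{X}))$ such that (i) $\mathsf{k}_j(\{X_i:i\in\mathcal{I}_j\},\mathbf{T}(\underline{X}))=K$ a.s. for all $j$; (ii) $K$ is uniform on $\mathbb{F}$; (iii) $I(K;\mathbf{T}(\underline{X}))=0$. ''$\{\mathcal{I}_j\}$ generates a SK'' means some protocol generates a SK. $\mathsf{S}_{\mathrm{L}}$ is the minimum number of transmissions of a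 linear protocol generating a SK. $\mathsf{M}^\star(\{\mathcal{I}_j\})$ is the optimal value of: minimize $\sum_{j\in[n]}a_j$ over $a\in\mathbb{Z}^n$ subject to $\sum_{j\in\mathcal{S}}a_j\ge\left|\bigcap_{j\in[n]\setminus\mathcal{S}}\bar{\mathcal{I}}_j\right|$ for every nonempty proper $\mathcal{S}\subsetneq[n]$, where $\bar{\mathcal{I}}_j=(\bigcup_i\mathcal{I}_i)\setminus\mathcal{I}_j$. Subfamily: $\{\mathcal{J}_j\}$ with $\mathcal{J}_j=\mathcal{I}_j\setminus\mathcal{R}$ for all $j$, for some $\mathcal{R}\subseteq\bigcup_j\mathcal{I}_j$. For an integer $\tau\ge1$, a family $\{\mathcal{J}_j\}$ is $\tau$-critical if (i) $|\bigcup_j\mathcal{J}_j|-\mathsf{M}^\star(\{\mathcal{J}_j\})=\tau$ and (ii) $\mathsf{M}^\star(\{\mathcal{J}_j\setminus\{i\}\})=\mathsf{M}^\star(\{\mathcal{J}_j\})$ for all $i\in\bigcup_j\mathcal{J}_j$. A minimum $\tau$-critical subfamily of $\{\mathcal{I}_j\}$ is a $\tau$-critical subfamily $\{\mathcal{J}^\star_j\}$ with $|\bigcup_j\mathcal{J}^\star_j|\le|\bigcup_j\mathcal{J}_j|$ for every $\tau$-critical subfamily $\{\mathcal{J}_j\}$ of $\{\mathcal{I}_j\}$. *)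

(* Defs.v *)
From HB Require Import structures.
From mathcomp Require Import all_boot all_order all_algebra.
From Stdlib Require Import ClassicalEpsilon.
Set Implicit Arguments. Unset Strict Implicit. Unset Printing Implicit Defensive.
Import GRing.Theory Num.Theory.
Local Open Scope ring_scope.
Local Open Scope nat_scope.

(* Messages are indexed by 'I_m; a family assigns to each client j : 'I_n
   its set of message indices.  A realisation of all messages is a finite
   function X : {ffun 'I_m -> F}; the messages are i.i.d. uniform, i.e. X is
   uniform on {ffun 'I_m -> F}, so probabilities are counting ratios. *)

Definition fam_union (n m : nat) (I : 'I_n -> {set 'I_m}) : {set 'I_m} :=
  \bigcup_(j < n) I j.

Definition Mfeasible (n m : nat) (I : 'I_n -> {set 'I_m}) (a : 'I_n -> int) : Prop :=
  forall S : {set 'I_n}, S != set0 -> S != setT ->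
    (#|\bigcap_(j in ~: S) (fam_union I :\: I j)|%:Z <= \sum_(j in S) a j)%R.

Definition is_Mstar (n m : nat) (I : 'I_n -> {set 'I_m}) (v : int) : Prop :=
  (exists a, Mfeasible I a /\ (\sum_(j < n) a j)%R = v) /\
  (forall a, Mfeasible I a -> (v <= \sum_(j < n) a j)%R).

Definition Mstar (n m : nat) (I : 'I_n -> {set 'I_m}) : int :=
  epsilon (inhabits (0 : int)) (is_Mstar I).

Definition subfamily (n m : nat) (I J : 'I_n -> {set 'I_m}) : Prop :=
  exists R : {set 'I_m}, R \subset fam_union I /\ forall j, J j = I j :\: R.

Definition critical (n m : nat) (tau : nat) (J : 'I_n -> {set 'I_m}) : Prop :=
  (#|fam_union J|%:Z - Mstar J = tau%:Z)%R /\
  (forall i, i \in fam_union J -> Mstar (fun j => J j :\ i) = Mstar J).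

Definition min_critical (n m : nat) (tau : nat) (I J : 'I_n -> {set 'I_m}) : Prop :=
  subfamily I J /\ critical tau J /\
  (forall J', subfamily I J' -> critical tau J' -> #|fam_union J| <= #|fam_union J'|).

Definition local (F : finFieldType) (m : nat) (A : {set 'I_m})
    (g : {ffun 'I_m -> F} -> seq F -> F) : Prop :=
  forall (X X' : {ffun 'I_m -> F}) (p : seq F), (forall i, i \in A -> X i = X' i) -> g X p = g X' p.

Fixpoint transcript (F : finFieldType) (m : nat)
    (f : nat -> {ffun 'I_m -> F} -> seq F -> F) (k : nat) (X : {ffun 'I_m -> F})
    : seq F :=
  if k is k'.+1 then
    let p := transcript f k' X in rcons p (f k' X p)
  else [::].

Definition is_protocol (F : finFieldType) (n m : nat) (I : 'I_n -> {set 'I_m})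
    (t : nat) (sched : nat -> 'I_n) (f : nat -> {ffun 'I_m -> F} -> seq F -> F) : Prop :=
  forall r, r < t -> local (I (sched r)) (f r).

Definition is_linear (F : finFieldType) (n m : nat) (I : 'I_n -> {set 'I_m})
    (t : nat) (sched : nat -> 'I_n) (f : nat -> {ffun 'I_m -> F} -> seq F -> F) : Prop :=
  exists c : nat -> 'I_m -> F, forall r, r < t -> forall X p,
    f r X p = (\sum_(i in I (sched r)) c r i * X i)%R.

Definition generates_SK_by (F : finFieldType) (n m : nat) (I : 'I_n -> {set 'I_m})
    (t : nat) (f : nat -> {ffun 'I_m -> F} -> seq F -> F) : Prop :=
  exists (k : 'I_n -> {ffun 'I_m -> F} -> seq F -> F) (K : {ffun 'I_m -> F} -> F),
    (forall j, local (I j) (k j)) /\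
    (forall j X, k j X (transcript f t X) = K X) /\
    (forall c : F, #|[set X : {ffun 'I_m -> F} | K X == c]| * #|F|
                   = #|{: {ffun 'I_m -> F}}|) /\
    (* I(K;T) = 0, i.e. K and T independent *)
    (forall (c : F) (tau : seq F),
       #|[set X : {ffun 'I_m -> F} | (K X == c) && (transcript f t X == tau)]|
         * #|{: {ffun 'I_m -> F}}|
       = #|[set X : {ffun 'I_m -> F} | K X == c]|
         * #|[set X : {ffun 'I_m -> F} | transcript f t X == tau]|).

Definition generates_SK (F : finFieldType) (n m : nat) (I : 'I_n -> {set 'I_m}) : Prop :=
  exists t sched f, @is_protocol F n m I t sched f /\ generates_SK_by I t f.

Definition linear_SK_in (F : finFieldType) (n m : nat) (I : 'I_n -> {set 'I_m})
    (t : nat) : Prop :=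
  exists sched f, @is_protocol F n m I t sched f /\ is_linear I t sched f /\
    generates_SK_by I t f.

Definition is_SL (F : finFieldType) (n m : nat) (I : 'I_n -> {set 'I_m}) (v : int) : Prop :=
  (exists t, v = t%:Z /\ @linear_SK_in F n m I t) /\
  (forall t, @linear_SK_in F n m I t -> (v <= t%:Z)%R).

(* Main.v *)
(* Lower bound.  Write the [t] transmissions of a linear protocol as [x *m C] and
   let [V_j] be the vectors of [ker C] vanishing on [I_j]: client [j] cannot tell
   [x] from [x + v] for [v] in [V_j], so the key is invariant under
   [V = \sum_j V_j], and secrecy makes [V] a proper subspace of [ker C].  If [U]
   is the complement of an information set of [V], then no nonzero vector
   supported on [U] lies in any [V_j], so all clients recover the messages of [U];
   counting independent transmissions per client gives a feasible point, whence
   [Mstar (I :&: U) <= \rank C < #|U|].  Shrinking [U] to a minimal set of positive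
   slack yields a 1-critical subfamily with [Mstar <= t].

   Upper bound.  For a feasible [a], Hall's theorem says that in a matrix with
   [a_j] columns of support [J_j] (and otherwise generic entries) some minor
   certifying recovery by client [j] is not identically zero.  These [n] minors are
   affine in each entry, so [n < #|F|] allows choosing the entries one at a time
   keeping all minors nonzero.  The code has [#|U| - 1] columns, hence kills some
   nonzero [w] supported on [U]; a message [X_i] with [w_i != 0] is then a key,
   because shifting along [w] changes it uniformly without changing the broadcasts. *)

Require Import Defs.
From HB Require Import structures.
From mathcomp Require Import all_boot all_order all_algebra.
From Stdlib Require Import ClassicalEpsilon.
From mathcomp Require Import zify.
Set Implicit Arguments. Unset Strict Implicit. Unset Printing Implicit Defensive.
Import Order.TTheory GRing.Theory Num.Theory.

(** * Hall's theorem, simultaneous non-vanishing, and schedules *)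

Lemma hall (D T : finType) (N : D -> {set T}) :
  (forall A : {set D}, #|A| <= #|\bigcup_(d in A) N d|) ->
  exists2 g : D -> T, injective g & forall d, g d \in N d.
Proof.
have [k] := ubnP (\sum_d #|N d|); elim: k N => // k IHk N leNk hallN.
have N_gt0 d : 0 < #|N d|.
  by have := hallN [set d]; rewrite cards1 big_set1.
have [/existsP[d /card_gt1P[x [y [xNd yNd neq_xy]]]] | /existsPn N_le1] :=
  boolP [exists d, 1 < #|N d|]; last first.
  have /fin_all_exists[g gN] d : exists t, t \in N d by apply/card_gt0P.
  exists g => // d e eq_g; apply/eqP/negPn/negP => neq_de.
  have := hallN [set d; e]; rewrite cards2 neq_de big_setU1 ?inE //= big_set1.
  have N1 c : N c = [set g c].
    apply/esym/eqP; rewrite eqEcard sub1set gN cards1 leqNgt.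
    exact: N_le1.
  by rewrite !N1 eq_g setUid cards1.
(* Rado's argument: one of two elements of [N d] can be dropped while keeping
   Hall's condition, by submodularity of the cardinality of neighbourhoods. *)
pose del z c := if c == d then N c :\ z else N c.
have del_small z : z \in N d ->
    (forall A : {set D}, #|A| <= #|\bigcup_(c in A) del z c|) ->
    exists2 g : D -> T, injective g & forall c, g c \in N c.
  move=> zNd /IHk[]; last first.
    move=> g g_inj gN; exists g => // c.
    by have := gN c; rewrite /del; case: ifP => // _ /setD1P[].
  rewrite -ltnS; apply: leq_trans leNk; rewrite ltnS.
  rewrite (bigD1 d) //= [X in _ < X](bigD1 d) //= /del eqxx.
  rewrite [X in _ <= X + _](cardsD1 z) zNd add1n addSn ltnS.
  by rewrite leq_add2l; apply: leq_sum => c /negPf ->.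
(* A set violating Hall's condition after dropping [z] must contain [d], since the other
   neighbourhoods are unchanged; it is recorded with [d] removed. *)
have violated z : z \in N d ->
    ~~ [forall A : {set D}, #|A| <= #|\bigcup_(c in A) del z c|] ->
    exists2 A : {set D}, d \notin A &
      #|(\bigcup_(c in A) N c) :|: (N d :\ z)| <= #|A|.
  move=> zNd /forallPn[A]; rewrite -ltnNge => ltA.
  have dA : d \in A.
    apply: contraLR ltA => dA; rewrite -leqNgt (leq_trans (hallN A)) //.
    rewrite (eq_bigr (del z)) // => c cA; rewrite /del; case: eqP => // eq_cd.
    by rewrite -eq_cd cA in dA.
  exists (A :\ d); first by rewrite !inE eqxx.
  move: ltA; rewrite (cardsD1 d A) dA add1n ltnS; apply: leq_trans.
  rewrite [X in _ <= #|pred_of_set X|](big_setD1 d) //= {1}/del eqxx setUC.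
  rewrite (eq_bigr (del z)) // => c /setD1P[/negPf neq_cd _].
  by rewrite /del neq_cd.
have [/forallP/(del_small _ xNd) // | /(violated _ xNd)[A dA leA]] :=
  boolP [forall A : {set D}, #|A| <= #|\bigcup_(c in A) del x c|].
have [/forallP/(del_small _ yNd) // | /(violated _ yNd)[B dB leB]] :=
  boolP [forall A : {set D}, #|A| <= #|\bigcup_(c in A) del y c|].
set P := _ :|: _ in leA; set Q := _ :|: _ in leB.
(* As [x != y], the sets [N d :\ x] and [N d :\ y] together cover [N d]. This yields the extra unit
   contradicting [leA] and [leB]. *)
have leU : #|d |: (A :|: B)| <= #|P :|: Q|.
  apply: leq_trans (hallN _) (subset_leq_card _); apply/bigcupsP => c.
  rewrite !inE => /or3P[/eqP-> | cA | cB].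
  - apply/subsetP=> z zNd; rewrite !inE zNd !andbT.
    by case: (eqVneq z x) => [-> | _]; rewrite ?neq_xy ?orbT.
  - by rewrite (subset_trans _ (subsetUl _ _)) // (subset_trans _ (subsetUl _ _)) // bigcup_sup.
  - by rewrite (subset_trans _ (subsetUr _ _)) // (subset_trans _ (subsetUl _ _)) // bigcup_sup.
have leI : #|A :&: B| <= #|P :&: Q|.
  apply: leq_trans (hallN _) (subset_leq_card _); apply/bigcupsP => c /setIP[cA cB].
  rewrite subsetI (subset_trans _ (subsetUl _ _)) ?bigcup_sup //.
  by rewrite (subset_trans _ (subsetUl _ _)) // bigcup_sup.
have := cardsUI A B; have := cardsUI P Q.
move: leU; rewrite cardsU1 inE negb_or dA dB /=; lia.
Qed.

(* The entries are fixed one at a time: each [f j] excludes at most one value. *)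
Lemma common_nonzero (F : finFieldType) (n : nat) (E : finType)
    (f : 'I_n -> {ffun E -> F} -> F) :
  (forall j (x : {ffun E -> F}) e, exists a b, forall z,
    f j [ffun e' => if e' == e then z else x e'] = (a + z * b)%R) ->
  n < #|F| -> (forall j, exists x, f j x != 0%R) ->
  exists x, forall j, f j x != 0%R.
Proof.
move=> f_affine ltnF /fin_all_exists[y0 y0P].
case: n => [|n] in f f_affine ltnF y0 y0P *.
  by exists [ffun=> 0%R] => -[].
(* Each [f j] keeps its own witness [y j]; the witnesses are made to agree one coordinate at a
   time. *)
suff [y yP y_eq] : exists2 y : 'I_n.+1 -> {ffun E -> F}, (forall j, f j (y j) != 0%R) &
    forall j e, e \in enum E -> y j e = y ord0 e.
  exists (y ord0) => j; suff <- : y j = y ord0 by [].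
  by apply/ffunP=> e; rewrite y_eq // mem_enum.
elim: (enum E) => [|e s [y yP y_eq]]; first by exists y0.
pose upd j z : {ffun E -> F} := [ffun e' => if e' == e then z else y j e'].
pose bad j := [set z | f j (upd j z) == 0%R].
have bad_le1 j : #|bad j| <= 1.
  have [a [b fE]] := f_affine j (y j) e.
  apply/card_le1_eqP => z1 z2; rewrite !inE /upd !fE => /eqP fz1 /eqP fz2.
  have yE : y j = upd j (y j e).
    by apply/ffunP => e'; rewrite ffunE; case: eqP => [->|].
  have [b0 | b_neq0] := eqVneq b 0%R.
    by have := yP j; rewrite yE fE -fz1 b0 !mulr0 eqxx.
  by apply: (mulIf b_neq0); apply: (addrI a); rewrite fz1 fz2.
have /existsP[z /bigcupP z_good] : [exists z, z \notin \bigcup_j bad j].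
  apply: contraLR ltnF => /existsPn no_good; rewrite -leqNgt -cardsT.
  have /subset_leq_card/leq_trans-> // : [set: F] \subset \bigcup_j bad j.
    by apply/subsetP=> z _; apply/negPn/no_good.
  rewrite -[X in _ <= X](card_ord n.+1) -[X in _ <= X]sum1_card.
  elim/big_rec2: _ => [|j c A _ leA]; first by rewrite cards0.
  by rewrite (leq_trans (leq_card_setU _ _)) ?leq_add.
exists (upd^~ z) => [j | j e'].
  by apply/negP => fz0; apply: z_good; exists j; rewrite ?inE.
by rewrite inE !ffunE; case: eqP => //= _; apply: y_eq.
Qed.

Lemma exists_schedule (n : nat) (a : 'I_n -> nat) :
  exists s : 'I_(\sum_i a i) -> 'I_n,
    forall S : {set 'I_n}, #|[set k | s k \in S]| = \sum_(i in S) a i.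
Proof.
exists (@tagnat.sig1 n a) => S.
rewrite -sum1_card [RHS](eq_bigr (fun i => \sum_(j < a i) 1)); last by move=> i _; rewrite sum1_card card_ord.
rewrite sig_big_dep /= [RHS](reindex (@tagnat.sig n a)) /=; last first.
  by exists (@tagnat.rank n a) => ? _; rewrite (tagnat.sigK, tagnat.rankK).
by apply: eq_bigl => k; rewrite inE andbT.
Qed.

(** * The integer program and critical subfamilies *)

Section Mstar.
Variables n m : nat.
Hypothesis n_gt1 : 2 <= n.
Implicit Types (I J : 'I_n -> {set 'I_m}) (a : 'I_n -> int).

Lemma Mfeasible_ge0 I a : Mfeasible I a -> forall j, (0 <= a j)%R.
Proof.
move=> aP j; have -> : (a j = \sum_(i in [set j]) a i)%R by rewrite big_set1.
apply: le_trans (aP [set j] _ _) => //.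
  by apply/set0Pn; exists j; rewrite inE.
by apply/eqP => /(congr1 (fun A : {set _} => #|A|)); rewrite cards1 cardsT card_ord; lia.
Qed.

(** Feasible sums are nonnegative and the constant point [#|'I_m|] is feasible, so a least feasible
    sum exists by well-ordering of [nat]. *)
Lemma Mstar_spec I : is_Mstar I (Mstar I).
Proof.
apply: epsilon_spec.
have attained : exists k : nat, exists2 a, Mfeasible I a & (\sum_j a j = k%:Z)%R.
  exists (\sum_(j < n) #|'I_m|), (fun=> #|'I_m|%:Z%R); last by rewrite !sumr_const; lia.
  move=> S /set0Pn[j jS] _; rewrite [X in (_ <= X)%R](bigD1 j) //=.
  apply: (@le_trans _ _ #|'I_m|%:Z%R); first by rewrite lez_nat max_card.
  by rewrite lerDl; apply: sumr_ge0.
pose P k := if excluded_middle_informative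
  (exists2 a, Mfeasible I a & (\sum_j a j = k%:Z)%R) then true else false.
have PP k : reflect (exists2 a, Mfeasible I a & (\sum_j a j = k%:Z)%R) (P k).
  by rewrite /P; case: excluded_middle_informative => ?; constructor.
have exP : exists k, P k by case: attained => k /PP; exists k.
case: (ex_minnP exP) => k /PP[a aP aE] k_min.
exists k%:Z%R; split=> [|b bP]; first by exists a.
have b_ge0 : (0 <= \sum_j b j)%R by apply: sumr_ge0 => j _; apply: Mfeasible_ge0 bP j.
rewrite -(gez0_abs b_ge0) lez_nat; apply/k_min/PP; exists b => //.
by rewrite gez0_abs.
Qed.

Lemma Mstar_le I a : Mfeasible I a -> (Mstar I <= \sum_j a j)%R.
Proof. by have [_] := Mstar_spec I; apply. Qed.

Lemma Mstar_ge0 I : (0 <= Mstar I)%R.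
Proof.
have [[a [aP <-]] _] := Mstar_spec I.
by apply: sumr_ge0 => j _; apply: Mfeasible_ge0 aP j.
Qed.

(** Shrinking the sets of missing indices weakens every constraint, so an optimal point for [I]
    stays feasible for [J]. *)
Lemma Mstar_mono I J : (forall j, fam_union J :\: J j \subset fam_union I :\: I j) ->
  (Mstar J <= Mstar I)%R.
Proof.
move=> JI; have [[a [aP <-]] _] := Mstar_spec I; apply: Mstar_le => S S0 ST.
apply: le_trans (aP S S0 ST); rewrite lez_nat; apply/subset_leq_card/bigcapsP => j jS.
by apply: subset_trans (JI j); apply: bigcap_inf.
Qed.

Lemma fam_unionI I (U : {set 'I_m}) :
  fam_union (fun j => I j :&: U) = fam_union I :&: U.
Proof. by rewrite /fam_union big_distrl. Qed.

Lemma Mstar_setI I (U V : {set 'I_m}) : U \subset V ->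
  (Mstar (fun j => I j :&: U) <= Mstar (fun j => I j :&: V))%R.
Proof.
move=> UV; apply: Mstar_mono => j; rewrite !fam_unionI; apply/subsetP=> i.
rewrite !inE => /andP[nIj /andP[-> iU]]; rewrite iU andbT in nIj.
by rewrite (negPf nIj) (subsetP UV).
Qed.

Lemma eq_Mstar I J : I =1 J -> Mstar I = Mstar J.
Proof.
have le_Mstar I' J' : I' =1 J' -> (Mstar J' <= Mstar I')%R.
  move=> eqIJ; apply: Mstar_mono => j; rewrite /fam_union eqIJ.
  by rewrite [X in _ \subset X :\: _](eq_bigr J').
by move=> eqIJ; apply/eqP; rewrite eq_le !le_Mstar // => j.
Qed.

(* A minimal [V] with positive slack [#|V| - Mstar] is 1-critical: deleting an
   index lowers [#|V|] by one and does not raise [Mstar]. *)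
Lemma critical_subfamily I (U : {set 'I_m}) : U \subset fam_union I ->
  (Mstar (fun j => I j :&: U) < #|U|%:Z)%R ->
  exists J, [/\ subfamily I J, critical 1 J & (Mstar J <= Mstar (fun j => I j :&: U))%R].
Proof.
move=> UI slackU; pose slack V := (Mstar (fun j => I j :&: V) < #|V|%:Z)%R.
have [V /minsetP[slackV minV] VU] := minset_exists (P := slack) slackU.
have unionV : fam_union (fun j => I j :&: V) = V.
  by rewrite fam_unionI; apply/setIidPr/(subset_trans VU).
have tight i : i \in V -> [/\ (Mstar (fun j => I j :&: V) = #|V|%:Z - 1)%R &
    Mstar (fun j => I j :&: (V :\ i)) = Mstar (fun j => I j :&: V)].
  move=> iV; have := Mstar_setI I (subD1set V i).
  have /negP : ~ slack (V :\ i).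
    by move=> /minV/(_ (subD1set V i))/setP/(_ i); rewrite !inE eqxx iV.
  rewrite /slack -leNgt; move: slackV; rewrite /slack (cardsD1 i V) iV; lia.
exists (fun j => I j :&: V); split; last exact: Mstar_setI.
  exists (fam_union I :\: V); split=> [|j]; first exact: subsetDl.
  apply/setP=> i; rewrite !inE; have [iIj | ] := boolP (i \in I j); rewrite ?andbF //=.
  have -> : i \in fam_union I by apply/bigcupP; exists j.
  by rewrite !andbT negbK.
split=> [|i]; rewrite unionV.
  (* An empty [V] with positive slack would make [Mstar] negative. *)
  have [V0 | [i /tight[-> _]]] := set_0Vmem V; last lia.
  by have := Mstar_ge0 (fun j => I j :&: V); move: slackV; rewrite /slack V0 cards0; lia.
move=> /tight[_ <-]; apply: eq_Mstar => j; apply/setP=> k.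
by rewrite !inE; case: (k == i); rewrite ?andbF.
Qed.

End Mstar.

Local Open Scope ring_scope.

(** * Kernels, information sets and determinants *)

Section LinearAlgebra.
Variables (F : fieldType) (m : nat).

(** There are fewer equations than unknowns: take a left kernel vector of the submatrix on rows [D]
    and columns [R], and extend it by zero. *)
Lemma supported_kernel (r : nat) (C : 'M[F]_(m, r)) (D : {set 'I_m}) (R : {set 'I_r}) :
  (#|R| < #|D|)%N ->
  exists x : 'rV[F]_m, [/\ x != 0, forall i, i \notin D -> x 0 i = 0 &
    forall k, k \in R -> (x *m C) 0 k = 0].
Proof.
move=> ltRD; pose G := mxsub (@enum_val _ (mem D)) (@enum_val _ (mem R)) C.
have /rowV0Pn[u /sub_kermxP uG u0] : kermx G != 0.
  by rewrite -mxrank_eq0 mxrank_ker -lt0n subn_gt0 (leq_ltn_trans (rank_leq_col G)).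
pose x := u *m rowsub (@enum_val _ (mem D)) 1%:M.
have xE i : x 0 i = \sum_d u 0 d * (enum_val d == i)%:R.
  by rewrite mxE; apply: eq_bigr => d _; rewrite !mxE.
exists x; split.
- apply: contraNneq u0 => x0; apply/eqP/rowP=> d; rewrite mxE.
  transitivity (x 0 (enum_val d)); last by rewrite x0 mxE.
  rewrite xE (bigD1 d) //= eqxx mulr1 big1 ?addr0 // => e neq_ed.
  by rewrite (inj_eq enum_val_inj) (negPf neq_ed) mulr0.
- move=> i iD; rewrite xE big1 // => d _; case: eqP => [di | _]; last by rewrite mulr0.
  by rewrite -di enum_valP in iD.
- move=> k kR; have <- : (u *m G) 0 (enum_rank_in kR k) = 0 by rewrite uG mxE.
  rewrite /x -mulmxA -rowsubE !mxE; apply: eq_bigr => d _.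
  by rewrite !mxE enum_rankK_in.
Qed.

(** A maximal independent set of columns of [V] is an information set: a vector of the row space
    that vanishes there is zero. *)
Lemma complement_information_set (V : 'M[F]_m) :
  exists2 U : {set 'I_m}, #|U| = (m - \rank V)%N &
    forall x : 'rV[F]_m, (x <= V)%MS -> (forall i, i \notin U -> x 0 i = 0) -> x = 0.
Proof.
pose f := maxrankfun V^T; exists (~: [set f k | k in setT]).
  by rewrite cardsCs setCK card_imset ?cardsT ?card_ord ?mxrank_tr //; apply: maxrankfun_inj.
move=> x /submxP[u xE] x0.
have /submxP[B VE] : (V^T <= rowsub f V^T)%MS by rewrite eq_maxrowsub.
rewrite xE -[V]trmxK VE trmx_mul mulmxA (_ : u *m _ = 0) ?mul0mx //.
apply/rowP=> k; rewrite mxE [RHS]mxE -[RHS](x0 (f k)); last by rewrite inE negbK imset_f ?inE.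
by rewrite xE !mxE; apply: eq_bigr => i _; rewrite !mxE.
Qed.

(** Only row [k] depends on [z]; by multilinearity the slope is the determinant with that row
    replaced by [v]. *)
Lemma det_entry_affine (d : nat) (B : F -> 'M[F]_d) (k : 'I_d) (v : 'rV[F]_d) :
  (forall z i j, B z i j = B 0 i j + z * ((i == k)%:R * v 0 j)) ->
  exists a b, forall z, \det (B z) = a + z * b.
Proof.
move=> BE; pose C := \matrix_(i, j) (if i == k then v 0 j else B 0 i j).
exists (\det (B 0)), (\det C) => z; rewrite -[X in _ = X + _]mul1r.
apply: (determinant_multilinear (i0 := k)).
- by apply/rowP=> j; rewrite !mxE [LHS]BE eqxx !mul1r.
- by apply/matrixP=> i j; rewrite !mxE [RHS]BE eq_sym (negPf (neq_lift _ _)) mul0r mulr0 addr0.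
- apply/matrixP=> i j; rewrite !mxE [lift _ _ == _]eq_sym (negPf (neq_lift _ _)).
  by rewrite [RHS]BE eq_sym (negPf (neq_lift _ _)) mul0r mulr0 addr0.
Qed.

End LinearAlgebra.

(** * Lower bound: slack from a matrix that leaves room for a key *)

Section Converse.
Variables (F : finFieldType) (n m : nat) (I : 'I_n -> {set 'I_m}).
Hypothesis n_gt1 : (2 <= n)%N.

(** The space [V_j]: the diagonal matrix projects onto the coordinates in [I j], so its kernel
    consists of the vectors vanishing there. *)
Definition unobserved (r : nat) (C : 'M[F]_(m, r)) (j : 'I_n) : 'M[F]_m :=
  (kermx C :&: kermx (diag_mx (\row_(i < m) (i \in I j)%B%:R)))%MS.

Lemma unobservedP (r : nat) (C : 'M[F]_(m, r)) (j : 'I_n) (x : 'rV[F]_m) :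
  reflect (x *m C = 0 /\ forall i, i \in I j -> x 0 i = 0) (x <= unobserved C j)%MS.
Proof.
rewrite sub_capmx; apply: (iffP andP) => -[/sub_kermxP xC xI]; split=> //.
- move=> i iI; move/sub_kermxP/rowP/(_ i): xI.
  by rewrite mul_mx_diag !mxE iI mulr1.
- apply/sub_kermxP/rowP=> i; rewrite mul_mx_diag !mxE.
  by case: (boolP (i \in I j)) => [/xI-> | _]; rewrite ?mul0r ?mulr0.
Qed.

Lemma slack_of_linear_key (t : nat) (C : 'M[F]_(m, t)) (sched : 'I_t -> 'I_n) :
  (forall i r, i \notin I (sched r) -> C i r = 0) ->
  (\rank (\sum_j unobserved C j)%MS < \rank (kermx C))%N ->
  exists U : {set 'I_m}, [/\ U \subset fam_union I,
    Mstar (fun j => I j :&: U) < #|U|%:Z & Mstar (fun j => I j :&: U) <= t%:Z].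
Proof.
set V := (\sum_j _)%MS => Csupp; rewrite mxrank_ker => ltVW.
have [U cardU Uinj] := complement_information_set V.
have unobs j (x : 'rV_m) : x *m C = 0 -> (forall i, i \in I j -> x 0 i = 0) ->
    (forall i, i \notin U -> x 0 i = 0) -> x = 0.
  move=> xC xI; apply: Uinj; apply: (submx_trans _ (sumsmx_sup j _ (submx_refl _))) => //.
  exact/unobservedP.
(* For an index [i] of [U] held by nobody, the unit vector at [i] would be unobserved and supported
   on [U]. *)
have UI : U \subset fam_union I.
  apply/subsetP=> i iU; apply/negPn/negP => /bigcupP niI.
  have j0 : 'I_n by apply: Ordinal n_gt1.
  have nI j : i \notin I j by apply/negP => iIj; apply: niI; exists j.
  have : delta_mx 0 i = 0 :> 'rV[F]_m.
    apply: (unobs j0) => [|k kI|k kU].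
    - by apply/rowP=> r; rewrite -rowE !mxE Csupp.
    - by rewrite mxE eqxx /=; case: eqP => // ki; have := nI j0; rewrite -ki kI.
    - by rewrite mxE eqxx /=; case: eqP => // ki; rewrite ki iU in kU.
  by move/rowP/(_ i)/eqP; rewrite !mxE !eqxx oner_eq0.
pose g := maxrankfun C^T; pose s k := sched (g k).
have rankE : \rank C^T = \rank C by apply: mxrank_tr.
have kerC (x : 'rV_m) : (forall k, (x *m C) 0 (g k) = 0) -> x *m C = 0.
  move=> xC; have /submxP[B CE] : (C^T <= rowsub g C^T)%MS by rewrite eq_maxrowsub.
  rewrite -[C]trmxK CE trmx_mul mulmxA (_ : x *m _ = 0) ?mul0mx //.
  apply/rowP=> k; rewrite mxE [RHS]mxE -[RHS](xC k) [RHS]mxE; apply: eq_bigr => i _.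
  by rewrite !mxE.
(* Only a maximal independent set of columns is counted, so that the total is [\rank C], which is
   less than [#|U|]. *)
pose a (j : 'I_n) : int := #|[set k | s k == j]|%:Z.
have sum_a (S : {set 'I_n}) : \sum_(j in S) a j = #|[set k | s k \in S]|%:Z.
  rewrite /a -(big_morph Posz PoszD (erefl _)); congr Posz.
  rewrite -sum1_card (partition_big s (mem S)) /= => [|k]; last by rewrite inE.
  apply: eq_bigr => j jS; rewrite -sum1_card; apply: eq_bigl => k; rewrite !inE.
  by apply/esym; case: eqP => [->|]; rewrite ?jS ?andbF.
have aP : Mfeasible (fun j => I j :&: U) a.
  move=> S S0 ST; rewrite sum_a lez_nat fam_unionI leqNgt; apply/negP.
  set D := \bigcap_(j in _) _ => ltD.
  (* A nonzero [x] on [D] is killed by the selected columns sent from [S]; the other senders hold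
     nothing in [D], so [x *m C = 0], and [unobs] forces [x = 0]. *)
  have [x [x0 xD xC]] := supported_kernel C (D := D) (R := g @: [set k | s k \in S])
    (leq_ltn_trans (leq_imset_card _ _) ltD).
  have [j jS] : exists j, j \in ~: S.
    by apply/set0Pn; apply: contraNneq ST => SC0; rewrite -[S]setCK SC0 setC0.
  have xDI i c : c \in ~: S -> i \in I c -> x 0 i = 0.
    move=> cS iI; have [iD | /xD //] := boolP (i \in D).
    by move/bigcapP/(_ c cS): iD; rewrite !inE iI /=; case: (i \in U); rewrite ?andbF.
  case/negP: x0; apply/eqP/(unobs j) => [|i|i iU]; first apply: kerC => k.
  - have [kS | kS] := boolP (s k \in S); first by apply: xC; rewrite imset_f ?inE.
    rewrite mxE big1 // => i _; have [iI | /Csupp->] := boolP (i \in I (s k)).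
      by rewrite (xDI i (s k)) ?mul0r // inE.
    by rewrite mulr0.
  - exact: xDI.
  - apply: xD; apply/negP => /bigcapP/(_ j jS).
    by rewrite !inE (negPf iU) !andbF.
have Mle := Mstar_le n_gt1 aP.
have sumT : \sum_j a j = (\rank C)%:Z.
  transitivity (\sum_(j in setT) a j); first by apply: eq_bigl => j; rewrite inE.
  rewrite sum_a (_ : [set k | _] = setT); first by rewrite cardsT card_ord rankE.
  by apply/setP=> k; rewrite !inE.
rewrite sumT in Mle; exists U; split=> //.
  apply: le_lt_trans Mle _; rewrite cardU ltz_nat.
  by have := rank_leq_row C; lia.
by apply: le_trans Mle _; rewrite lez_nat rank_leq_col.
Qed.

End Converse.

(** * Transcripts of linear protocols *)

Section Transcript.
Variables (F : finFieldType) (m t : nat).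
Variables (f : nat -> {ffun 'I_m -> F} -> seq F -> F) (C : 'M[F]_(m, t)).
Hypothesis fE : forall (r : 'I_t) X p, f r X p = ((\row_i X i) *m C) 0 r.

(** Linear broadcasts ignore earlier ones, so the transcript just lists the coordinates of the
    product with [C]. *)
Lemma eq_transcript_linear X Y :
  transcript f t X = transcript f t Y <-> (\row_i X i) *m C = (\row_i Y i) *m C.
Proof.
pose g Z k := f k Z [::].
have transcriptE Z : transcript f t Z = mkseq (g Z) t.
  elim: {-2}t (leqnn t) => // k IHk ltkt /=.
  by rewrite (IHk (ltnW ltkt)) mkseqS /g !(fE (Ordinal ltkt)).
rewrite !transcriptE; split=> eqXY.
  by apply/rowP=> r; have /(congr1 (nth 0 ^~ r)) := eqXY; rewrite !nth_mkseq // /g !fE.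
apply/eq_in_map => k; rewrite mem_iota => /andP[_ ltkt].
by rewrite /g !(fE (Ordinal ltkt)) eqXY.
Qed.

End Transcript.

(** * From keys to matrices and back *)

Section KeyProtocol.
Variables (F : finFieldType) (n m : nat) (I : 'I_n -> {set 'I_m}).
Hypothesis n_gt1 : (2 <= n)%N.

Lemma slack_of_linear_SK (t : nat) : linear_SK_in F I t ->
  exists U : {set 'I_m}, [/\ U \subset fam_union I,
    Mstar (fun j => I j :&: U) < #|U|%:Z & Mstar (fun j => I j :&: U) <= t%:Z].
Proof.
case=> sched [f [_ [[c fc] [k [K [k_local [kK [K_unif K_indep]]]]]]]].
(* The coefficients [c] are arbitrary off the transmitter's indices, hence the masking. *)
pose C : 'M[F]_(m, t) := \matrix_(i, r) (if i \in I (sched r) then c r i else 0).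
have fE (r : 'I_t) X p : f r X p = ((\row_i X i) *m C) 0 r.
  rewrite fc // mxE big_mkcond; apply: eq_bigr => i _.
  by rewrite !mxE; case: ifP; rewrite ?mulr0 // mulrC.
have eq_tr := eq_transcript_linear fE.
apply: (@slack_of_linear_key F n m I n_gt1 t C (fun r => sched r)).
  by move=> i r /negPf iI; rewrite mxE iI.
rewrite ltnNge; apply/negP => rankW; set V := (\sum_j _)%MS in rankW.
pose ofrow (x : 'rV[F]_m) : {ffun 'I_m -> F} := [ffun i => x 0 i].
have ofrowK x : \row_i ofrow x i = x by apply/rowP=> i; rewrite !mxE ffunE.
have rowK (X : {ffun 'I_m -> F}) : ofrow (\row_i X i) = X.
  by apply/ffunP=> i; rewrite ffunE mxE.
(* Split [v] into its [V_j] components and remove them in turn, computing the key through client [j]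
   for the component in [V_j]. *)
have K_shift (v x : 'rV_m) : (v <= V)%MS -> K (ofrow (x + v)) = K (ofrow x).
  case/sub_sumsmxP=> u ->; move: x.
  elim/big_rec: _ => [x | j w _ IHw x]; first by rewrite addr0.
  have /unobservedP[wC wI] : (u j *m unobserved I C j <= unobserved I C j)%MS by apply: submxMl.
  rewrite addrA IHw -!(kK j) (proj2 (eq_tr _ (ofrow x))); last by rewrite !ofrowK mulmxDl wC addr0.
  by apply: k_local => i iI; rewrite !ffunE mxE wI ?addr0.
have WV : (kermx C <= V)%MS.
  have VW : (V <= kermx C)%MS by apply/sumsmx_subP => j _; apply: capmxSl.
  by rewrite -(mxrank_leqif_sup VW) eqn_leq rankW mxrankS.
have K_ker X : transcript f t X = transcript f t (ofrow 0) -> K X = K (ofrow 0).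
  move/eq_tr; rewrite ofrowK mul0mx => /sub_kermxP XW.
  by rewrite -(rowK X) -[X in ofrow X]add0r K_shift // (submx_trans XW).
pose tau := transcript f t (ofrow 0).
(* Were [V] all of [ker C], the transcript of the zero message would determine the key. Then the key
   value [K (ofrow 0) + 1] and [tau] never occur together, though each has positive probability. *)
have := K_indep (K (ofrow 0) + 1) tau; rewrite (_ : [set X | _ & _] = set0); last first.
  apply/setP=> X; rewrite !inE; apply/negP => /andP[/eqP KX /eqP/K_ker].
  by rewrite KX => /eqP; rewrite addrC -subr_eq0 addrK oner_eq0.
rewrite cards0 mul0n => /esym/eqP; rewrite muln_eq0 => /orP[/eqP K0 | ].
  by have := K_unif (K (ofrow 0) + 1); rewrite K0 mul0n => /esym/card0_eq/(_ (ofrow 0)).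
by rewrite cards_eq0 => /eqP/setP/(_ (ofrow 0)); rewrite !inE eqxx.
Qed.

(** Shifting by [c2 - c1] injects one fibre of [K] into another, so all [#|F|] fibres have equal
    size. This serves both uniformity ([P] trivial) and secrecy ([P] fixing the transcript). *)
Lemma card_shift_invariant (T : finType) (K : T -> F) (sh : F -> T -> T) (P : pred T) :
  (forall z, injective (sh z)) -> (forall z X, K (sh z X) = K X + z) ->
  (forall z X, P (sh z X) = P X) ->
  forall c, (#|[set X | (K X == c) && P X]| * #|F| = #|[set X | P X]|)%N.
Proof.
move=> sh_inj Ksh Psh c.
have le_fibre c1 c2 :
    (#|[set X | (K X == c1) && P X]| <= #|[set X | (K X == c2) && P X]|)%N.
  rewrite -(card_imset _ (sh_inj (c2 - c1))); apply/subset_leq_card/subsetP=> Y.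
  case/imsetP=> X XP ->; move: XP; rewrite !inE Ksh Psh => /andP[/eqP-> ->].
  by rewrite addrC subrK eqxx.
rewrite -[RHS]sum1_card (partition_big K predT) //= mulnC -sum_nat_const.
apply: eq_bigr => d _; transitivity #|[set X | (K X == d) && P X]|.
  by apply/eqP; rewrite eqn_leq !le_fibre.
by rewrite -sum1_card; apply: eq_bigl => X; rewrite !inE andbC.
Qed.

Lemma linear_SK_of_code (M : nat) (C : 'M[F]_(m, M)) (s : 'I_M -> 'I_n)
    (U : {set 'I_m}) :
  (M < #|U|)%N -> (forall i r, i \notin I (s r) -> C i r = 0) ->
  (forall j (x : 'rV[F]_m), (forall i, i \in I j -> x 0 i = 0) -> x *m C = 0 ->
    forall i, i \in U -> x 0 i = 0) ->
  linear_SK_in F I M.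
Proof.
move=> ltMU Csupp recover.
(* Rounds are natural numbers: from [M] on, client 0 sends zero. *)
pose sched r := if insub r is Some k then s k else Ordinal (ltnW n_gt1).
pose c r i := if insub r is Some k then C i k else 0.
pose f r (X : {ffun 'I_m -> F}) (_ : seq F) := \sum_(i in I (sched r)) c r i * X i.
have fE (r : 'I_M) X p : f r X p = ((\row_i X i) *m C) 0 r.
  rewrite /f /sched /c insubT //= => ltrM; rewrite mxE big_mkcond.
  rewrite (_ : Sub _ _ = r); last exact: val_inj.
  apply: eq_bigr => i _; rewrite mxE mulrC.
  by case: ifPn => // /Csupp->; rewrite mulr0.
have eq_tr := eq_transcript_linear fE.
exists sched, f; split; first by move=> r _ X Y p XY; apply: eq_bigr => i iI; rewrite XY.
split; first by exists c.
have [w [w0 wU wC]] : exists w : 'rV[F]_m, [/\ w != 0, forall i, i \notin U -> w 0 i = 0 &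
    w *m C = 0].
  have [|w [w0 wU wC]] := supported_kernel C (D := U) (R := setT).
    by rewrite cardsT card_ord.
  by exists w; split=> //; apply/rowP=> r; rewrite wC ?mxE.
have [i0 w_i0] : exists i, w 0 i != 0 by apply/rV0Pn.
have i0U : i0 \in U by apply: contraNT w_i0 => /wU->.
(* Dividing by [w 0 i0] makes the shift add exactly [z] to the key. *)
pose sh z (X : {ffun 'I_m -> F}) : {ffun 'I_m -> F} := [ffun i => X i + z / w 0 i0 * w 0 i].
have sh_tr z X : transcript f M (sh z X) = transcript f M X.
  apply/eq_tr; rewrite (_ : \row_i sh z X i = \row_i X i + (z / w 0 i0) *: w).
    by rewrite mulmxDl -scalemxAl wC scaler0 addr0.
  by apply/rowP=> i; rewrite !mxE ffunE.
have sh_inj z : injective (sh z).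
  by move=> X Y /ffunP eqXY; apply/ffunP=> i; have := eqXY i; rewrite !ffunE => /addIr.
have sh_key z X : sh z X i0 = X i0 + z by rewrite ffunE divfK.
pose consistent j (X : {ffun 'I_m -> F}) p (Y : {ffun 'I_m -> F}) :=
   [forall i, (i \in I j) ==> (X i == Y i)] && (transcript f M Y == p).
have K_unif d : (#|[set X : {ffun 'I_m -> F} | X i0 == d]| * #|F| = #|{: {ffun 'I_m -> F}}|)%N.
  have := card_shift_invariant (P := predT) sh_inj sh_key (fun _ _ => erefl) d.
  rewrite (_ : [set X | predT X] = setT) ?cardsT; last by apply/setP=> X; rewrite !inE.
  by move=> <-; congr muln; apply: eq_card => X; rewrite !inE andbT.
(* Client [j] picks any message vector consistent with its data; [recover] gives it the true value
   at [i0]. On an actual transcript [X] itself is consistent, so the default 0 is not reached. *)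
exists (fun j X p => if pick (consistent j X p) is Some Y then Y i0 else 0), (fun X => X i0).
split; [|split; [|split]].
- move=> j X Y p XY; rewrite (@eq_pick _ _ (consistent j Y p)) // => Z.
  rewrite /consistent; congr andb; apply: eq_forallb => i.
  by case: (boolP (i \in I j)) => //= /XY->.
- move=> j X; case: pickP => [Y /andP[/forallP XY /eqP/eq_tr YX] | /(_ X)]; last first.
    by rewrite /consistent eqxx andbT => /negbT/forallPn[i]; rewrite eqxx implybT.
  apply/eqP; rewrite -subr_eq0.
  have := recover j (\row_i Y i - \row_i X i) _ _ i0 i0U; rewrite !mxE => -> //.
    by move=> i /(implyP (XY i))/eqP eqXY; rewrite !mxE eqXY subrr.
  by rewrite mulmxBl YX subrr.
- exact: K_unif.
- move=> d tau.
  have sh_tau z X : (transcript f M (sh z X) == tau) = (transcript f M X == tau).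
    by rewrite sh_tr.
  have <- := card_shift_invariant (P := fun X => transcript f M X == tau) sh_inj sh_key sh_tau d.
  by rewrite -(K_unif d) mulnCA.
Qed.

End KeyProtocol.

(** * Upper bound: codes from feasible points *)

Lemma exists_omniscience_code (F : finFieldType) (n m : nat) (J : 'I_n -> {set 'I_m})
    (a : 'I_n -> int) :
  (2 <= n)%N -> (n < #|F|)%N -> Mfeasible J a ->
  exists (M : nat) (C : 'M[F]_(m, M)) (s : 'I_M -> 'I_n),
    [/\ M%:Z = \sum_j a j, forall i r, i \notin J (s r) -> C i r = 0 &
      forall j (x : 'rV[F]_m), (forall i, i \in J j -> x 0 i = 0) -> x *m C = 0 ->
        forall i, i \in fam_union J -> x 0 i = 0].
Proof.
move=> n_gt1 ltnF aP; set U := fam_union J.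
have [s s_card] := exists_schedule (fun j => `|a j|%N).
set M := (\sum_j _)%N in s s_card.
have aE (S : {set 'I_n}) : #|[set k | s k \in S]|%:Z = \sum_(j in S) a j.
  rewrite s_card (big_morph Posz PoszD (erefl _)); apply: eq_bigr => j _.
  by rewrite gez0_abs //; apply: Mfeasible_ge0 aP j.
have ME : M%:Z = \sum_j a j.
  rewrite /M (big_morph Posz PoszD (erefl _)); apply: eq_bigr => j _.
  by rewrite gez0_abs //; apply: Mfeasible_ge0 aP j.
pose h j : 'I_#|U :\: J j| -> 'I_m := @enum_val _ (mem (U :\: J j)).
have h_inj j : injective (h j) := @enum_val_inj _ _.
(* Each index missing at [j] gets its own column, sent by a client holding it. For Hall's condition
   at [A], apply feasibility to the set [S] of holders of some index in [A]; it is proper because it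
   omits [j]. *)
have matching j : exists2 g : 'I_#|U :\: J j| -> 'I_M, injective g &
    forall d, h j d \in J (s (g d)).
  have [A | g g_inj gP] := hall (N := fun d => [set k | h j d \in J (s k)]); last first.
    by exists g => // d; have := gP d; rewrite inE.
  have [-> | [d0 d0A]] := set_0Vmem A; first by rewrite cards0.
  pose S := [set i | [exists d in A, h j d \in J i]].
  have -> : \bigcup_(d in A) [set k | h j d \in J (s k)] = [set k | s k \in S].
    apply/setP=> k; rewrite !inE; apply/bigcupP/exists_inP => -[d dA].
      by rewrite inE => dk; exists d.
    by exists d; rewrite ?inE.
  rewrite -lez_nat aE; apply: le_trans (aP S _ _).
  - rewrite lez_nat -(card_imset _ (h_inj j)); apply/subset_leq_card/subsetP=> _ /imsetP[d dA ->].
    apply/bigcapP=> i; rewrite !inE => /exists_inPn/(_ d dA) ->.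
    by have /setDP[] := enum_valP d.
  - have /setDP[/bigcupP[i _ d0i] _] := enum_valP d0.
    by apply/set0Pn; exists i; rewrite inE; apply/exists_inP; exists d0.
  - apply: contraTneq (in_setT j) => <-; rewrite inE; apply/exists_inPn => d _.
    by have /setDP[] := enum_valP d.
have {matching} /fin_all_exists2[g g_inj gP] : forall j, exists2 g : 'I_#|U :\: J j| -> 'I_M,
    injective g & forall d, h j d \in J (s (g d)) by exact: matching.
pose code (x : {ffun 'I_m * 'I_M -> F}) : 'M_(m, M) :=
  \matrix_(i, k) (if i \in J (s k) then x (i, k) else 0).
pose f j x := \det (mxsub (h j) (g j) (code x)).
have [j x [i k]|//| j |x fx] := @common_nonzero F n _ f.
(* Entry [(i, k)] occurs in the minor only when [i] is missing at [j], and then only in the row of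
   [i]. *)
- have [d /= /eqP hd | no_h] := pickP (fun d => h j d == i); last first.
    exists (f j x), 0 => z; rewrite mulr0 addr0; congr (\det _); apply/matrixP=> d l.
    by rewrite !mxE ffunE xpair_eqE no_h.
  apply: (det_entry_affine (k := d) (v := \row_l ((i \in J (s k)) && (g j l == k))%:R)).
  move=> z d' l; rewrite !mxE !ffunE !xpair_eqE -hd (inj_eq (@h_inj j)).
  case: eqP => [->|_] /=; last by rewrite mul0r mulr0 addr0.
  case: eqP => [->|_]; last by rewrite andbF mulr0 mulr0 addr0.
  by case: ifP => _; rewrite !(mul1r, mulr1, mulr0, add0r).
(* The 0/1 indicator of the matching turns the minor into the identity. *)
- exists [ffun p => [exists d, (h j d == p.1) && (g j d == p.2)]%:R].
  rewrite /f (_ : mxsub _ _ _ = 1%:M) ?det1 ?oner_neq0 //.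
  apply/matrixP=> d l; rewrite !mxE ffunE /=; have [<- | neq_dl] := eqVneq d l.
    by rewrite gP; case: existsP => // -[]; exists d; rewrite !eqxx.
  case: ifP => // _; case: existsP => // -[e /andP[]].
  by move=> /eqP/h_inj-> /eqP/g_inj eq_dl; rewrite eq_dl eqxx in neq_dl.
exists M, (code x), s; split=> // [i r /negPf iJ | j v vJ vC i iU]; first by rewrite mxE iJ.
have [iJ | iJ] := boolP (i \in J j); first exact: vJ.
pose u := \row_d v 0 (h j d).
(* [v] vanishes on [J j] and the code vanishes off [U], so only the rows of the minor contribute. *)
have : u *m mxsub (h j) (g j) (code x) = 0.
  apply/rowP=> l; transitivity ((v *m code x) 0 (g j l)); last by rewrite vC !mxE.
  rewrite !mxE (bigID (mem (U :\: J j))) /= [X in _ = _ + X]big1 ?addr0; last first.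
    move=> c; rewrite !inE negb_and negbK => /orP[/vJ-> | cU]; first by rewrite mul0r.
    rewrite mxE ifN ?mulr0 //; apply: contra cU => cJ.
    by apply/bigcupP; exists (s (g j l)).
  by rewrite [RHS]big_enum_val; apply: eq_bigr => d _; rewrite !mxE.
have iD : i \in U :\: J j by rewrite inE iJ.
move/(congr1 (mulmx^~ (invmx (mxsub (h j) (g j) (code x))))).
rewrite mulmxK ?unitmxE ?unitfE ?fx // mul0mx => /rowP/(_ (enum_rank_in iD i)).
by rewrite !mxE /h enum_rankK_in.
Qed.

(** * The minimum number of linear transmissions *)

Theorem theorem5 (F : finFieldType) (n m : nat) (I : 'I_n -> {set 'I_m}) :
  (2 <= n)%N -> (n < #|F|)%N -> generates_SK F I ->
  forall J : 'I_n -> {set 'I_m}, min_critical 1 I J ->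
    is_SL F I (Mstar J) /\ Mstar J = (#|fam_union J|%:Z - 1)%R.
Proof.
move=> n_gt1 ltnF _ J [[R [_ JE]] [[slackJ _] minJ]].
have MstarE : Mstar J = #|fam_union J|%:Z - 1 by move: slackJ; lia.
split=> //; split; last first.
  move=> t /(slack_of_linear_SK n_gt1)[U [UI slackU leUt]].
  have [J' [IJ' critJ' leJ'U]] := critical_subfamily n_gt1 UI slackU.
  (* Both families are 1-critical, so comparing their unions compares their [Mstar]. *)
  by have := minJ _ IJ' critJ'; case: critJ' => slackJ' _; lia.
have [[a [aP aE]] _] := Mstar_spec n_gt1 J.
have [M [C [s [ME Csupp recover]]]] := exists_omniscience_code n_gt1 ltnF aP.
exists M; split; first by rewrite ME.
(* Under [I] each client holds at least its messages under [J], so the code for [J] can still be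
   sent and decoded. *)
have JI j i : i \in J j -> i \in I j by rewrite JE => /setDP[].
apply: (linear_SK_of_code n_gt1 (C := C) (s := s) (U := fam_union J)).
- by rewrite -ltz_nat ME aE MstarE; lia.
- by move=> i r iI; apply: Csupp; apply: contra iI => /JI.
- by move=> j x xI; apply: (recover j x) => i /JI/xI.
Qed.
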